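(* Let $\Gamma$ be a finite connected triangle-free and square-free graph. (1) There exists a constant $M$ which depends only on $\Gamma$ such that if $v,v'\in\Gamma^e$ are vertices then $\mathrm{diam}_{\mathrm{Lk}(v)}\,\pi_v(v')\le M$. (2) With the same constant $M$: let $v\in\Gamma^e$ be a vertex and let $K\subseteq\Gamma^e$ be a connected subset contained outside of the closed ball of radius two about $v$; then $\mathrm{diam}_{\mathrm{Lk}(v)}\,\pi_v(K)\le M$. Furthermore, there exists a constant $M'$ which depends only on $\Gamma$ such that if $v\in\Gamma^e$ is a vertex and $X\subseteq\Gamma^e$ is a geodesic segment, ray, or bi-infinite line contained in $\Gamma^e\setminus\mathrm{St}(v)$, then $\mathrm{diam}_{\mathrm{Lk}(v)}\,\pi_v(X)\le M'$.
   Context: Graphs are simplicial. Triangle-free (square-free) means no induced subgraph is a $3$-cycle ($4$-cycle). $A(\Gamma)=\langle V(\Gamma)\mid [a,b]=1 \text{ for each } \{a,b\}\in E(\Gamma)\rangle$. The extension graph $\Gamma^e$ has vertex set $\{v^g : v\in V(\Gamma), g\in A(\Gamma)\}$, $v^g=g^{-1}vg$, with two distinct vertices adjacent iff they commute; it carries the graph metric. $\mathrm{Lk}(v)=\mathrm{Lk}_{\Gamma^e}(v)$ is the set of vertices of $\Gamma^e$ adjacent to $v$, and $\mathrm{St}(v)=\mathrm{Lk}(v)\cup\{v\}$. A set of vertices is connected if the subgraph of $\Gamma^e$ it spans is connected. Vertex link projection: for vertices $v,v'$ of $\Gamma^e$, $G(v,v')$ is the set of geodesic paths in $\Gamma^e$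 from $v$ to $v'$, and $\pi_v(v')=\bigcup_{\delta\in G(v,v')}\delta\cap\mathrm{Lk}(v)$. For a set $X$ of vertices, $\pi_v(X)=\bigcup_{v'\in X}\pi_v(v')$. Metric on links: since $\Gamma$ is triangle-free, $L=\mathrm{Lk}_\Gamma(u)$ is discrete for each $u\in V(\Gamma)$, so $F=\langle L\rangle\le A(\Gamma)$ is free on $L$. One has $\mathrm{Lk}_{\Gamma^e}(u)=\{w^g : w\in L, g\in F\}$, identified with the extension graph $L^e$ of the discrete graph $L$, which is the graph on this vertex set in which two distinct vertices $w_1^{g_1}, w_2^{g_2}$ are adjacent iff there is $g\in F$ with $w_1^{g_1}=w_1^{g}$ and $w_2^{g_2}=w_2^{g}$. The metric on $\mathrm{Lk}_{\Gamma^e}(u)$ is the graph metric of $L^e$. For a general vertex $v=u^h$ of $\Gamma^e$, $\mathrm{Lk}(v)=\mathrm{Lk}(u)^h$ carries the metric transported by conjugation by $h$. $\mathrm{diam}_{\mathrm{Lk}(v)}$ is the diameter in this metric (with $\mathrm{diam}(\varnothing)=0$). *)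

(* Defs.v *)
From HB Require Import structures.
From mathcomp Require Import all_boot generic_quotient all_order all_algebra.
From mathcomp Require Import boolp classical_sets.

Set Implicit Arguments.
Unset Strict Implicit.
Unset Printing Implicit Defensive.

Local Open Scope classical_set_scope.
Local Open Scope quotient_scope.
Local Open Scope group_scope.

Section FiniteGraphs.
Variables (V : finType) (E : rel V).

Definition triangle_free :=
  forall a b c : V, ~ [/\ uniq [:: a; b; c], E a b, E b c & E c a].

Definition square_free :=
  forall a b c d : V,
    ~ [/\ uniq [:: a; b; c; d],
          [/\ E a b, E b c, E c d & E d a], ~~ E a c & ~~ E b d].

End FiniteGraphs.

(* The group A(Gamma) is the set of words in the letters v (coded (v, true))
   and v^-1 (coded (v, false)), modulo the congruence generated by deleting
   x x^-1, x^-1 x, and the commutators a^-1 b^-1 a b for {a, b} an edge. *)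
Section RAAG.
Variables (V : finType) (E : rel V).

Definition word := seq (V * bool).

Definition letter_inv (x : V * bool) : V * bool := (x.1, ~~ x.2).
Definition word_inv (w : word) : word := rev (map letter_inv w).

Inductive relator : word -> Prop :=
| relator_cancel x : relator [:: x; letter_inv x]
| relator_comm a b : E a b ->
    relator [:: (a, false); (b, false); (a, true); (b, true)].

Inductive word_eq : word -> word -> Prop :=
| word_eq_relator u r w : relator r -> word_eq (u ++ r ++ w) (u ++ w)
| word_eq_refl u : word_eq u u
| word_eq_sym u w : word_eq u w -> word_eq w u
| word_eq_trans u t w : word_eq u t -> word_eq t w -> word_eq u w.

Definition word_eqb : rel word := fun u w => `[< word_eq u w >].

Lemma word_eqb_refl : reflexive word_eqb.
Proof. by move=> u; apply/asboolP; exact: word_eq_refl. Qed.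

Lemma word_eqb_sym : symmetric word_eqb.
Proof. by move=> u w; apply/asboolP/asboolP; exact: word_eq_sym. Qed.

Lemma word_eqb_trans : transitive word_eqb.
Proof.
by move=> t u w /asboolP ut /asboolP tw; apply/asboolP; exact: word_eq_trans tw.
Qed.

Canonical word_eqb_equiv :=
  EquivRel word_eqb word_eqb_refl word_eqb_sym word_eqb_trans.

Definition raag := {eq_quot word_eqb}.

HB.instance Definition _ := Choice.on raag.
HB.instance Definition _ := EqQuotient.on raag.

Lemma raag_eq (u w : word) : word_eq u w -> \pi_raag u = \pi_raag w.
Proof. by move=> uw; apply/(@eqmodP _ word_eqb_equiv)/asboolP. Qed.

Lemma word_eq_cat u u' w w' :
  word_eq u u' -> word_eq w w' -> word_eq (u ++ w) (u' ++ w').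
Proof.
move=> uu' ww'; apply: (@word_eq_trans _ (u' ++ w)).
  elim: uu' => {u u' ww'} [u r t rr|u|u t _|u t s _ + _].
  - by rewrite -!catA; exact: word_eq_relator.
  - exact: word_eq_refl.
  - exact: word_eq_sym.
  - exact: word_eq_trans.
elim: ww' => {u uu' w w'} [u r t rr|u|u t _|u t s _ + _].
- by rewrite !(catA u'); exact: word_eq_relator.
- exact: word_eq_refl.
- exact: word_eq_sym.
- exact: word_eq_trans.
Qed.

Lemma letter_invK : involutive letter_inv.
Proof. by case=> a b; rewrite /letter_inv /= negbK. Qed.

Lemma word_invK : involutive word_inv.
Proof. by move=> w; rewrite /word_inv map_rev revK mapK //; exact: letter_invK. Qed.

Lemma word_mulV w : word_eq (w ++ word_inv w) [::].
Proof.
elim: w => [|x w IHw]; first exact: word_eq_refl.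
rewrite /word_inv /= rev_cons -cats1 catA -/(word_inv w).
apply: word_eq_trans (@word_eq_relator [::] _ [::] (relator_cancel x)) => /=.
by apply: (@word_eq_cat [:: x] [:: x] _ [:: letter_inv x]);
  [exact: word_eq_refl | exact: (word_eq_cat IHw (word_eq_refl _))].
Qed.

Lemma word_Vmul w : word_eq (word_inv w ++ w) [::].
Proof. by rewrite -{2}[w]word_invK; exact: word_mulV. Qed.

Lemma word_eq_inv u w : word_eq u w -> word_eq (word_inv u) (word_inv w).
Proof.
move=> uw; apply: (@word_eq_trans _ (word_inv u ++ (w ++ word_inv w))).
  rewrite -{1}[word_inv u]cats0; apply: word_eq_cat; first exact: word_eq_refl.
  exact/word_eq_sym/word_mulV.
rewrite catA -[word_inv w in X in word_eq _ X]cat0s.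
apply: word_eq_cat; last exact: word_eq_refl.
apply: word_eq_trans (word_Vmul u).
by apply: word_eq_cat; [exact: word_eq_refl | exact: word_eq_sym].
Qed.

Definition raag_one : raag := \pi_raag [::].
Definition raag_mul (x y : raag) : raag := \pi_raag (repr x ++ repr y).
Definition raag_inv (x : raag) : raag := \pi_raag (word_inv (repr x)).

Lemma word_eq_repr (w : word) : word_eq (repr (\pi_raag w)) w.
Proof.
by apply/asboolP; apply/(@eqmodP _ word_eqb_equiv); rewrite reprK.
Qed.

Lemma raag_mulE u w : raag_mul (\pi_raag u) (\pi_raag w) = \pi_raag (u ++ w).
Proof. by apply: raag_eq; apply: word_eq_cat; exact: word_eq_repr. Qed.

Lemma raag_invE u : raag_inv (\pi_raag u) = \pi_raag (word_inv u).
Proof. by apply: raag_eq; apply: word_eq_inv; exact: word_eq_repr. Qed.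

Lemma raag_mulA : associative raag_mul.
Proof.
elim/quotW=> x; elim/quotW=> y; elim/quotW=> z.
by rewrite (raag_mulE y z) (raag_mulE x y) !raag_mulE catA.
Qed.

Lemma raag_mul1 : left_id raag_one raag_mul.
Proof. by elim/quotW=> x; rewrite raag_mulE. Qed.

Lemma raag_mulr1 : right_id raag_one raag_mul.
Proof. by elim/quotW=> x; rewrite raag_mulE cats0. Qed.

Lemma raag_mulV : left_inverse raag_one raag_inv raag_mul.
Proof.
elim/quotW=> x; rewrite raag_invE raag_mulE.
by apply: raag_eq; exact: word_Vmul.
Qed.

Lemma raag_mulrV : right_inverse raag_one raag_inv raag_mul.
Proof.
elim/quotW=> x; rewrite raag_invE raag_mulE.
by apply: raag_eq; exact: word_mulV.
Qed.

HB.instance Definition _ := isGroup.Build raag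
  raag_mulA raag_mul1 raag_mulr1 raag_mulV raag_mulrV.

Definition raag_gen (v : V) : raag := \pi_raag [:: (v, true)].

End RAAG.

(* A graph on (a subset of) a type T is given by its adjacency relation; a path
   from x is a sequence p with path e x p, its vertices being x :: p. *)
Section GraphMetric.
Variables (T : eqType) (e : rel T).

(* d(x, y) <= n *)
Definition dist_le (x y : T) (n : nat) : Prop :=
  exists p : seq T, [/\ path e x p, last x p = y & (size p <= n)%N].

(* d(x, y) = n *)
Definition dist_eq (x y : T) (n : nat) : Prop :=
  dist_le x y n /\ forall m : nat, dist_le x y m -> (n <= m)%N.

Definition diam_le (S : set T) (n : nat) : Prop :=
  forall x y : T, S x -> S y -> dist_le x y n.

Definition geodesic (x y : T) (p : seq T) : Prop :=
  [/\ path e x p, last x p = y & dist_eq x y (size p)].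

Definition connected_set (S : set T) : Prop :=
  forall x y : T, S x -> S y ->
    exists p : seq T, [/\ path e x p, last x p = y & {in p, forall z, S z}].

Definition geodesic_segment (S : set T) : Prop :=
  exists x y p, geodesic x y p /\ S = [set z | z \in x :: p].

Definition geodesic_ray (S : set T) : Prop :=
  exists c : nat -> T,
    (forall i n : nat, dist_eq (c i) (c (i + n)%N) n) /\ S = range c.

Definition geodesic_line (S : set T) : Prop :=
  exists c : int -> T,
    (forall (i : int) (n : nat), dist_eq (c i) (c (i + n%:Z)%R) n) /\ S = range c.

End GraphMetric.

Definition generated_subgroup (G : groupType) (S : set G) : set G :=
  smallest (fun H : set G => H 1 /\ forall x y, H x -> H y -> H (x / y)) S.

Section ExtensionGraph.
Variables (V : finType) (E : rel V).

Local Notation A := (raag E).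

Definition ext_vertex : set A :=
  [set x | exists (v : V) (g : A), x = raag_gen E v ^ g].

Definition ext_adj : rel A := fun x y =>
  `[< [/\ ext_vertex x, ext_vertex y, x <> y & commute x y] >].

Definition Lk (v : A) : set A := [set x | ext_adj v x].

Definition St (v : A) : set A := v |` Lk v.

Definition proj (v v' : A) : set A :=
  [set x | exists p, [/\ geodesic ext_adj v v' p, x \in v :: p & Lk v x]].

Definition proj_set (v : A) (X : set A) : set A :=
  \bigcup_(v' in X) proj v v'.

Definition link_group (u : V) : set A :=
  generated_subgroup [set x | exists2 w, E u w & x = raag_gen E w].

(* Adjacency in L^e, L being the link of u in Gamma: the vertices x and y are
   conjugates of elements of L by a common element of the subgroup <L>. *)
Definition link_adj (u : V) : rel A := fun x y =>
  `[< x <> y /\ exists w1 w2 g,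
        [/\ E u w1, E u w2, link_group u g,
            x = raag_gen E w1 ^ g & y = raag_gen E w2 ^ g] >].

(* The metric on Lk(v) for v = u^h is that of L^e transported by conjugation by
   h. It does not depend on the choice of u and h (two choices of h differ by
   an element of the centralizer of u); the bound is imposed for all of them. *)
Definition link_diam_le (v : A) (S : set A) (n : nat) : Prop :=
  forall (u : V) (h : A), v = raag_gen E u ^ h ->
    diam_le (link_adj u) [set x ^ h^-1 | x in S] n.

End ExtensionGraph.

(* Main.v *)
Require Import Defs.
From mathcomp Require Import all_boot generic_quotient all_order all_algebra.
From mathcomp Require Import boolp classical_sets.

Set Implicit Arguments.
Unset Strict Implicit.
Unset Printing Implicit Defensive.

Local Open Scope classical_set_scope.

(** The proof gives M = 1 and M' = 6 for every graph.  It rests on two facts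
    about a vertex v of the extension graph.

    Local rigidity: no two vertices of Lk(v) are adjacent, and two distinct
    vertices of Lk(v) have v as their only common neighbour
    ([Lk_independent], [Lk_common_neighbor]).

    Separation: if p and q lie in Lk(v) and are at distance at least 2 for the
    metric of the link, then some third vertex m of Lk(v) has a star St(m)
    that disconnects p from q in the extension graph ([link_separation]).

    Given these, let p be the first vertex after v on a geodesic from v to x.
    The rest of this geodesic avoids St(m) for every m in Lk(v) other than p
    ([geodesic_shadow]), so x lies on the same side of St(m) as p; such a p is
    called a shadow of x.  Two shadows of x, or shadows of two vertices joined
    by a path outside the ball of radius 2 about v, are therefore separated by
    no third star, hence at distance at most 1.  Along a geodesic that avoids
    St(v), the only vertices lying in some St(m) are those at distance 2 from
    v.  They are pairwise at distance at most 4, so there are at most 5 of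
    them, and each can move the shadow by at most 1: this is where 6 comes
    from.

    For separation, take v to be a generator u after conjugating.  To a
    generator l is attached a map [crossing l] from A to the infinite cyclic
    group generated by l.  Read a word for g as a path from 1 to g in the
    Cayley graph in which letters multiply on the left; [crossing l g] is the
    product of the letters l, l^-1 of the edges of this path that lie in the
    subgroup generated by the star of l.  This depends on g alone: every
    relator either backtracks or runs around a square, whose opposite edges
    belong to the subgroup together.  The same map shows that the centralizer of l is
    generated by the star of l ([commute_gen_parabolic]), that commuting
    conjugates of generators are simultaneously conjugate to commuting
    generators ([commute_gen_conj]), and that g -> [crossing l g] is constant
    on the vertices w^g of each component of the complement of St(l)
    ([crossing_joined]).  Finally, write p = w^g and q = z^(t g) with t a word
    in the neighbours of u that is as short as possible.  If p and q are at
    distance at least 2 in the link, then t is not empty, its last letter is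
    some l or l^-1 with l other than w, and [crossing l] distinguishes 1 from
    t: the star of l^g separates p from q. *)

(** * Distances and geodesics in a graph *)

Section Metric.
Variables (T : eqType) (e : rel T).

Lemma dist_leS x y m n : (m <= n)%N -> dist_le e x y m -> dist_le e x y n.
Proof.
by move=> mn [p [xp py pm]]; exists p; split=> //; exact: leq_trans mn.
Qed.

Lemma dist_le_trans x y z m n :
  dist_le e x y m -> dist_le e y z n -> dist_le e x z (m + n).
Proof.
move=> [p [xp py pm]] [q [yq qz qn]]; exists (p ++ q).
by rewrite cat_path last_cat size_cat py xp leq_add.
Qed.

Lemma dist_le_refl x n : dist_le e x x n.
Proof. by exists [::]. Qed.

Lemma rev_pathE x p : symmetric e ->
  path e (last x p) (rev (belast x p)) = path e x p.
Proof.
move=> esym; rewrite rev_path.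
by have/eq_path -> : (fun z => e^~ z) =2 e by move=> a b; rewrite esym.
Qed.

Lemma last_rev_belast (x : T) p : last (last x p) (rev (belast x p)) = x.
Proof. by case: p => //= y p; rewrite rev_cons last_rcons. Qed.

Lemma dist_le_sym x y n : symmetric e -> dist_le e x y n -> dist_le e y x n.
Proof.
move=> esym [p [xp <- pn]]; exists (rev (belast x p)).
by rewrite rev_pathE // last_rev_belast size_rev size_belast.
Qed.

Lemma geodesic_min x y p q :
  geodesic e x y p -> path e x q -> last x q = y -> (size p <= size q)%N.
Proof. by move=> [_ _ [_ h]] xq qy; apply: h; exists q. Qed.

Lemma geodesic_infix x y a b c : geodesic e x y (a ++ b ++ c) ->
  geodesic e (last x a) (last x (a ++ b)) b.
Proof.
move=> g; have [pth lst _] := g; move: pth lst.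
rewrite !cat_path !last_cat => /and3P[xa ab bc] lst; split=> //.
split; first by exists b.
move=> m [q [aq qb qm]]; apply: leq_trans qm.
have := geodesic_min g (q := a ++ q ++ c).
rewrite !cat_path !last_cat qb xa aq bc !size_cat leq_add2l leq_add2r.
exact.
Qed.

(** In a segment, a ray or a line, two points are the ends of a geodesic that
    stays in it; the orientation is left open because the points come in no
    particular order. *)
Lemma geodesic_segmentP S x y : geodesic_segment e S -> S x -> S y ->
  exists p, (geodesic e x y p \/ geodesic e y x p) /\ {in p, forall z, S z}.
Proof.
move=> [x0 [y0 [p0 [g ->]]]] /= xp0; case/splitPl: xp0 g => p1 p2 xE g yp.
have [yp2|] := boolP (y \in p2).
  case/splitPr: yp2 g {yp} => a b; rewrite -cat_rcons => g.
  exists (rcons a y); split.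
    by left; have := geodesic_infix g; rewrite last_cat last_rcons xE.
  by move=> z za; rewrite /= inE !mem_cat za orbT !orbT.
move: yp; rewrite -cat_cons mem_cat => /orP[|->//] yp1 _.
case/splitPl: yp1 xE g => a b yE xE; rewrite -catA => g; exists b; split.
  by right; have := geodesic_infix g; rewrite xE yE.
by move=> z zb; rewrite /= inE !mem_cat zb !orbT.
Qed.

Lemma dist_eq_adj x y : dist_eq e x y 1 -> e x y.
Proof.
move=> [[[|z [|w p]] [//= + xy _]] min]; last by rewrite -xy andbT.
by have := min 0%N; rewrite -xy => /(_ (dist_le_refl _ _)).
Qed.

Lemma geodesic_param (c : nat -> T) n :
  (forall i k, dist_eq e (c i) (c (i + k)%N) k) ->
  geodesic e (c 0%N) (c n) (map c (iota 1 n)).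
Proof.
move=> cE; have aux k : path e (c k) (map c (iota k.+1 n)) /\
    last (c k) (map c (iota k.+1 n)) = c (k + n)%N.
  elim: n k => [|n IH] k /=; first by rewrite addn0.
  have [-> ->] := IH k.+1; rewrite addSnnS; split=> //.
  by rewrite andbT; apply: dist_eq_adj; rewrite -addn1.
have [p l] := aux 0%N; split=> //; rewrite size_map size_iota.
exact: (cE 0%N).
Qed.

Lemma geodesic_rayP S x y : geodesic_ray e S -> S x -> S y ->
  exists p, (geodesic e x y p \/ geodesic e y x p) /\ {in p, forall z, S z}.
Proof.
move=> [c [cE ->]] [i _ <-] [j _ <-].
wlog ij : i j / (i <= j)%N.
  move=> H; have [ij|/ltnW ji] := leqP i j; first exact: H.
  have [p [gp Sp]] := H j i ji.
  by exists p; split=> //; case: gp; [right | left].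
have g := @geodesic_param (fun k => c (i + k)%N) (j - i).
exists (map (fun k => c (i + k)%N) (iota 1 (j - i))); split.
  left; move: g; rewrite addn0 subnKC //; apply=> k m; rewrite addnA; exact: cE.
by move=> z /mapP[k _ ->]; exists (i + k)%N.
Qed.

Lemma geodesic_lineP S x y : geodesic_line e S -> S x -> S y ->
  exists p, (geodesic e x y p \/ geodesic e y x p) /\ {in p, forall z, S z}.
Proof.
move=> [c [cE ->]] [i _ <-] [j _ <-].
wlog ij : i j / (i <= j)%R.
  move=> H; have [ij|ji] : (i <= j \/ j <= i)%R.
      exact/orP/Order.TotalTheory.le_total.
    exact: H.
  have [p [gp Sp]] := H j i ji.
  by exists p; split=> //; case: gp; [right | left].
have [n ->] : exists n : nat, j = (i + n%:Z)%R.
  exists `|(j - i)%R|%N; rewrite gez0_abs ?Num.Theory.subr_ge0 //.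
  by rewrite GRing.addrC GRing.subrK.
have g := @geodesic_param (fun k => c (i + k%:Z)%R) n.
exists (map (fun k : nat => c (i + k%:Z)%R) (iota 1 n)); split.
  left; move: g; rewrite GRing.addr0; apply=> k m.
  by rewrite PoszD GRing.addrA; exact: cE.
by move=> z /mapP[k _ ->]; exists (i + k%:Z)%R.
Qed.

(** Being in the same component of the complement of the star of m. *)
Definition joined_off (m x y : T) : Prop :=
  exists p, [/\ path e x p, last x p = y &
                {in x :: p, forall z, z != m /\ ~~ e m z}].

End Metric.

(** * Shadows in the link of a vertex *)

Section JoinedTheory.
Variables (T : eqType) (e : rel T).
Hypothesis esym : symmetric e.

Local Notation joined := (joined_off e).

Lemma joined_off_sym m x y : joined m x y -> joined m y x.
Proof.
move=> [p [xp <- av]]; exists (rev (belast x p)); split.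
- by rewrite rev_pathE.
- exact: last_rev_belast.
- by move=> z; rewrite -rev_rcons -lastI mem_rev; exact: av.
Qed.

Lemma joined_off_trans m x y z : joined m x y -> joined m y z -> joined m x z.
Proof.
move=> [p [xp py avp]] [q [yq qz avq]]; exists (p ++ q); split.
- by rewrite cat_path py xp.
- by rewrite last_cat py.
- move=> a; rewrite -cat_cons mem_cat => /orP[/avp//|aq].
  by apply: avq; rewrite inE aq orbT.
Qed.

Lemma joined_off_end m x y : joined m x y -> y != m /\ ~~ e m y.
Proof. by move=> [p [_ <- av]]; apply: av; exact: mem_last. Qed.

Lemma joined_off_edge m x y : e x y ->
  x != m /\ ~~ e m x -> y != m /\ ~~ e m y -> joined m x y.
Proof.
move=> xy xm ym; exists [:: y]; rewrite /= xy; split=> // z.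
by rewrite !inE => /orP[] /eqP ->.
Qed.

End JoinedTheory.

(** The argument here uses only that v is a vertex of a graph e whose link is
    independent ([indep]), contained in no square but through v ([common]),
    and carries a relation f for which vertices that no third star separates
    are at distance at most 1 ([unseparated]). *)
Section Shadows.
Variables (T : eqType) (e f : rel T) (v : T).
Hypotheses (esym : symmetric e) (eirr : irreflexive e).
Hypothesis indep : forall p q, e v p -> e v q -> ~~ e p q.
Hypothesis common : forall p q x,
  e v p -> e v q -> p <> q -> e p x -> e x q -> x = v.
Hypothesis unseparated : forall p q, e v p -> e v q ->
  (forall m, e v m -> m <> p -> m <> q -> joined_off e m p q) ->
  dist_le f p q 1.

Local Notation joined := (joined_off e).

(** The weakening of being the first vertex of a geodesic from v to x that
    propagates along paths avoiding the stars. *)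
Definition shadow (x p : T) : Prop :=
  e v p /\ forall m, e v m -> m <> p -> joined m p x.

(** A vertex of the geodesic after p that lies in the star of another vertex m
    of the link could be reached from v through m.  This gives a shorter path
    from v to x, except when that vertex comes right after p: it is then
    a common neighbour of p and m, hence v itself. *)
Lemma geodesic_shadow x s p :
  geodesic e v x s -> p \in v :: s -> e v p -> shadow x p.
Proof.
move=> g ps vp; split=> // m vm mp.
have {}ps : p \in s.
  by move: ps; rewrite inE => /orP[/eqP pv|//]; rewrite pv eirr in vp.
case/splitPr: ps g => s1 s2 g; have [+ + _] := g.
rewrite cat_path last_cat /= => /and3P[_ _ ps2] ls2.
have := geodesic_min g (q := p :: s2); rewrite /= vp => /(_ ps2 ls2).
rewrite size_cat -[X in (_ <= X)%N]add0n leq_add2r leqn0 size_eq0 => /eqP s10.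
(* The geodesic is now p followed by s2, and a vertex z of s2 splits it as
   p, a, z, b. *)
rewrite {s1}s10 cat0s in g; exists s2; split=> // z.
rewrite inE => /orP[/eqP ->|zs2].
  by split; [apply/eqP/nesym | exact: indep].
case/splitPr: zs2 ps2 ls2 g => a b; rewrite cat_path last_cat /=.
move=> /and3P[pa az zb] lb g.
have short q : path e v (q ++ b) -> last v (q ++ b) = x ->
    (size a + 2 <= size q)%N.
  move=> vq qx; have := geodesic_min g vq qx.
  by rewrite /= !size_cat /= addnS -2!addSn -addn2 leq_add2r.
split; apply/negP.
  move=> /eqP zm; have := short [:: m]; rewrite /= vm -zm zb => /(_ isT lb).
  by rewrite addn2.
move=> mz; case: a {g} pa az short => [_ /= pz|a0 a _ _] short.
  have zv : z = v by apply: (common vp vm) => //; [exact/nesym | rewrite esym].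
  by have := short [::]; rewrite /= -zv zb => /(_ isT lb).
have := short [:: m; z]; rewrite /= vm mz zb => /(_ isT lb).
by rewrite addn2.
Qed.

(** For m other than p and q, the star of m separates neither p from x nor y
    from q; if it does not separate x from y, it does not separate p from q. *)
Lemma shadows_close x y p q : shadow x p -> shadow y q ->
  (forall m, e v m -> m <> p -> m <> q -> joined m x y) -> dist_le f p q 1.
Proof.
move=> [vp xp] [vq yq] xy; apply: unseparated => // m vm mp mq.
apply: joined_off_trans (xp m vm mp) _.
apply: joined_off_trans (xy m vm mp mq) _.
exact/joined_off_sym/yq.
Qed.

Lemma shadows_close_same x p q : shadow x p -> shadow x q -> dist_le f p q 1.
Proof.
move=> xp xq; apply: (shadows_close xp xq) => m vm mp mq.
exists [::]; split=> // z; rewrite inE => /eqP ->.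
exact: joined_off_end (xp.2 m vm mp).
Qed.

Lemma shadows_close_connected (K : set T) x y p q :
  connected_set e K -> (forall z, K z -> ~ dist_le e v z 2) ->
  K x -> K y -> shadow x p -> shadow y q -> dist_le f p q 1.
Proof.
move=> Kc Kv Kx Ky xp yq; apply: (shadows_close xp yq) => m vm _ _.
have [s [xs sy Ks]] := Kc x y Kx Ky; exists s; split=> // z zs.
have {}/Kv Kz : K z by move: zs; rewrite inE => /orP[/eqP ->//|]; exact: Ks.
split; apply/negP.
  by move=> /eqP zm; apply: Kz; exists [:: z]; rewrite /= zm vm.
by move=> mz; apply: Kz; exists [:: m; z]; rewrite /= vm mz.
Qed.

(** Outside St(v), these are the vertices at distance exactly 2 from v, the
    only ones at which a shadow can be lost. *)
Definition touches_link : pred T := fun z => `[< exists2 m, e v m & e m z >].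

Lemma touches_link_shadow z m : z <> v -> e v m -> e m z -> shadow z m.
Proof.
move=> zv vm mz; split=> // m' vm' m'm; apply: joined_off_edge => //.
  by split; [apply/eqP/nesym | exact: indep].
split; apply/negP.
  by move=> /eqP zm'; rewrite zm' (negbTE (indep vm vm')) in mz.
by move=> m'z; apply: zv; apply: (common vm vm' _ mz); [exact/nesym | rewrite esym].
Qed.

(** A vertex of the path that touches no star keeps the current shadow; one
    that touches the star of m gets m as its own shadow, next to the
    previous one since no third star has been met. *)
Lemma shadow_along x s p q : path e x s ->
  {in s, forall z, z <> v /\ ~~ e v z} ->
  shadow x p -> shadow (last x s) q -> dist_le f p q (1 + count touches_link s).
Proof.
elim: s x p => [|y s IH] x p /=.
  by move=> _ _ xp xq; rewrite addn0; exact: shadows_close_same xp xq.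
move=> /andP[xy ys] off xp yq.
have [yv vy] : y <> v /\ ~~ e v y by apply: off; rewrite inE eqxx.
have {}off : {in s, forall z, z <> v /\ ~~ e v z}.
  by move=> z zs; apply: off; rewrite inE zs orbT.
have cross m : e v m -> m <> p -> y != m /\ ~~ e m y -> joined m x y.
  move=> vm mp; apply: joined_off_edge xy _.
  exact: joined_off_end (xp.2 m vm mp).
have [[m vm my]|ny] := pselect (exists2 m, e v m & e m y).
  have ym := touches_link_shadow yv vm my.
  have -> : touches_link y by apply/asboolP; exists m.
  apply: dist_le_trans (IH y m ys off ym yq).
  apply: (shadows_close xp ym) => m' vm' m'p m'm.
  by apply: cross => //; exact: joined_off_end (ym.2 m' vm' m'm).
have -> : touches_link y = false by apply/asboolP.
apply: (IH y) => //; split; first by case: xp.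
move=> m vm mp; apply: joined_off_trans (xp.2 m vm mp) _; apply: cross => //.
split; apply/negP; first by move=> /eqP ym; rewrite ym vm in vy.
by move=> my; apply: ny; exists m.
Qed.

(** Two vertices touching the link are joined through v by a path of length 4,
    so after the first one, at most the next 4 vertices of the geodesic can
    touch it. *)
Lemma geodesic_touches_link_count x y s :
  geodesic e x y s -> (count touches_link s <= 5)%N.
Proof.
elim: s x => // z s IH x g /=.
have gs : geodesic e z y s.
  have [_ + _] := g; have := @geodesic_infix _ e x y [:: z] s [::].
  by rewrite cats0 => /(_ g) /= gz <-.
have [/asboolP[m vm mz]|_] := boolP (touches_link z); last exact: IH gs.
suff : ~~ has touches_link (drop 4 s).
  rewrite has_count -leqNgt leqn0 => /eqP d0.
  rewrite -(cat_take_drop 4 s) count_cat d0 addn0 (leq_add2l 1 _ 4).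
  by apply: leq_trans (count_size _ _) _; rewrite size_take_min geq_minl.
apply/hasP => -[w ws /asboolP[m' vm' m'w]].
have s4 : (4 < size s)%N by rewrite -subn_gt0 -size_drop; case: (drop _ _) ws.
have [a [b dE]] : exists a b, drop 4 s = a ++ w :: b.
  by case/splitPr: ws => a b; exists a, b.
have [+ + _] := gs.
rewrite -{1 2}(cat_take_drop 4 s) dE !cat_path !last_cat /=.
move=> /and4P[_ _ _ wb] lb.
have := geodesic_min gs (q := [:: m; v; m'; w] ++ b).
rewrite /= (esym z) mz (esym m) vm vm' m'w wb => /(_ isT).
rewrite lb => /(_ erefl).
rewrite -(cat_take_drop 4 s) dE !size_cat /= size_takel ?(ltnW s4)//.
by rewrite -[(size b).+4]/(4 + size b)%N leq_add2l addnS ltnNge leq_addl.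
Qed.

Lemma geodesic_shadows_close x y s p q : geodesic e x y s ->
  {in s, forall z, z <> v /\ ~~ e v z} ->
  shadow x p -> shadow y q -> dist_le f p q 6.
Proof.
move=> g off xp yq; have [xs sy _] := g.
apply: dist_leS (shadow_along xs off xp _); last by rewrite sy.
by rewrite (leq_add2l 1 _ 5) (geodesic_touches_link_count g).
Qed.

End Shadows.

(** * Words and parabolic subgroups *)

Local Open Scope quotient_scope.
Local Open Scope group_scope.

Lemma commuteJ (G : groupType) (x y g : G) :
  commute (x ^ g) (y ^ g) <-> commute x y.
Proof.
by rewrite /commute -!conjMg; split=> [/conjg_inj|->].
Qed.

Lemma conjg_commute (G : groupType) (x g : G) : commute x g -> x ^ g = x.
Proof. by move=> xg; rewrite conjgE xg mulKg. Qed.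

Section ParabolicSubgroups.
Variables (V : finType) (E : rel V).
Hypotheses (Esym : symmetric E) (Eirr : irreflexive E).

Local Notation A := (raag E).
Local Notation gen := (raag_gen E).
Local Notation joined := (joined_off (@ext_adj V E)).

Definition eval_word (w : word V) : A := \pi_A w.

Lemma eval_cat u w : eval_word (u ++ w) = eval_word u * eval_word w.
Proof. by rewrite /eval_word -raag_mulE. Qed.

Lemma eval_cons x w : eval_word (x :: w) = eval_word [:: x] * eval_word w.
Proof. exact: (eval_cat [:: x]). Qed.

Lemma eval_nil : eval_word [::] = 1.
Proof. by []. Qed.

Lemma eval_inv w : eval_word (word_inv w) = (eval_word w)^-1.
Proof. by rewrite /eval_word -raag_invE. Qed.

Lemma eval_letter v b : eval_word [:: (v, b)] = if b then gen v else (gen v)^-1.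
Proof. by case: b => //; rewrite -(eval_inv [:: (v, true)]). Qed.

Lemma eval_repr (g : A) : eval_word (repr g) = g.
Proof. exact: reprK. Qed.

Lemma eval_inj u w : eval_word u = eval_word w -> word_eq E u w.
Proof. by move=> /eqmodP/asboolP. Qed.

Lemma gen_commute a b : E a b -> commute (gen a) (gen b).
Proof.
move=> Eab.
have : eval_word [:: (a, false); (b, false); (a, true); (b, true)] = 1.
  by have /raag_eq := word_eq_relator [::] [::] (relator_comm Eab).
rewrite -[X in eval_word X]/([:: _] ++ [:: _] ++ [:: _] ++ [:: _]).
rewrite !eval_cat !eval_letter /=.
by move/mulg1_eq; rewrite invgK /commute => {2}->; rewrite mulVKg.
Qed.

Definition spelled (S : pred V) (w : word V) := all (fun x => S x.1) w.

Definition parabolic (S : pred V) : set A :=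
  [set g | exists2 w, spelled S w & g = eval_word w].

Lemma parabolic1 S : parabolic S 1.
Proof. by exists [::]. Qed.

Lemma parabolicM S g h : parabolic S g -> parabolic S h -> parabolic S (g * h).
Proof.
move=> [u Su ->] [w Sw ->]; exists (u ++ w); last by rewrite eval_cat.
by rewrite /spelled all_cat; apply/andP.
Qed.

Lemma parabolicV S g : parabolic S g -> parabolic S g^-1.
Proof.
move=> [u Su ->]; exists (word_inv u); last by rewrite eval_inv.
by rewrite /spelled /word_inv all_rev all_map.
Qed.

Lemma parabolicMl S g h : parabolic S g -> parabolic S (g * h) <-> parabolic S h.
Proof.
move=> Sg; split; last exact: parabolicM.
by move=> /(parabolicM (parabolicV Sg)); rewrite mulKg.
Qed.

Lemma parabolicMr S g h : parabolic S g -> parabolic S (h * g) <-> parabolic S h.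
Proof.
move=> Sg; split; last by move=> Sh; exact: parabolicM Sh Sg.
by move=> /parabolicM/(_ (parabolicV Sg)); rewrite mulgK.
Qed.

Lemma parabolic_letter (S : pred V) x : S x.1 -> parabolic S (eval_word [:: x]).
Proof. by move=> Sx; exists [:: x] => //=; rewrite andbT. Qed.

Lemma parabolic_gen (S : pred V) v : S v -> parabolic S (gen v).
Proof. exact: (@parabolic_letter S (v, true)). Qed.

Lemma sub_parabolic (S T : pred V) :
  (forall v, S v -> T v) -> parabolic S `<=` parabolic T.
Proof.
by move=> ST g [w Sw ->]; exists w => //; apply: sub_all Sw => x; exact: ST.
Qed.

(** Killing the letters outside S respects the relators, hence retracts A onto
    the parabolic subgroup of S. *)
Lemma word_eq_filter (S : pred V) u w : word_eq E u w ->
  word_eq E (filter (fun x => S x.1) u) (filter (fun x => S x.1) w).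
Proof.
elim=> {u w} [u r w|u|u w _|u t w _ + _]; last 3 first.
- exact: word_eq_refl.
- exact: word_eq_sym.
- exact: word_eq_trans.
rewrite !filter_cat; case=> [x|a b Eab] /=.
  case: (S x.1); last exact: word_eq_refl.
  exact: (word_eq_relator _ _ (relator_cancel E x)).
case: (S a); case: (S b) => /=; last exact: word_eq_refl.
- exact: (word_eq_relator _ _ (relator_comm Eab)).
- exact: (word_eq_relator _ _ (relator_cancel E (a, false))).
- exact: (word_eq_relator _ _ (relator_cancel E (b, false))).
Qed.

(** Retract onto S: the element is fixed, while a word over T becomes a word
    over the intersection. *)
Lemma parabolicI (S T : pred V) g :
  parabolic S g -> parabolic T g -> parabolic (predI S T) g.
Proof.
move=> [u Su ->] [w Tw uw]; exists (filter (fun x => S x.1) w).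
  by rewrite /spelled all_filter; apply: sub_all Tw => x /= ->; apply/implyP=> ->.
by rewrite -{1}(all_filterP Su); apply/raag_eq/word_eq_filter/eval_inj.
Qed.

(** Exponent sums modulo 2 are enough to tell the conjugates of distinct
    generators apart. *)
Definition parity v (g : A) := odd (count (fun x => x.1 == v) (repr g)).

Lemma parity_eval v w :
  parity v (eval_word w) = odd (count (fun x => x.1 == v) w).
Proof.
rewrite /parity; move: (repr _) (word_eq_repr E w) => w'.
elim=> {w w'} [u r t|//|u t _ -> //|u s t _ -> _ -> //].
rewrite !count_cat !oddD; case=> [x|a b _] /=; last first.
  by case: (a == v); case: (b == v).
by case: (x.1 == v).
Qed.

Lemma parityM v g h : parity v (g * h) = parity v g (+) parity v h.
Proof.
by rewrite -(eval_repr g) -(eval_repr h) -eval_cat !parity_eval count_cat oddD.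
Qed.

Lemma parityJ v g h : parity v (g ^ h) = parity v g.
Proof.
by rewrite conjgE !parityM addbCA -parityM mulVg (parity_eval v [::]) addbF.
Qed.

Lemma parity_gen v w : parity v (gen w) = (w == v).
Proof. by rewrite (parity_eval v [:: (w, true)]) /= addn0 oddb. Qed.

Lemma parity_parabolic (S : pred V) v g :
  ~~ S v -> parabolic S g -> parity v g = false.
Proof.
move=> Sv [w Sw ->]; rewrite parity_eval (@eq_in_count _ _ pred0) ?count_pred0//.
by move=> x /(allP Sw) Sx; apply: contraNF Sv => /eqP <-.
Qed.

Lemma conj_gen_inj v w g h : gen v ^ g = gen w ^ h -> v = w.
Proof.
move=> /(congr1 (parity w)); rewrite !parityJ !parity_gen eqxx.
by move/eqP.
Qed.

(** * Crossing the edges of a star *)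

Definition star (l : V) : pred V := [pred z | (z == l) || E l z].

Lemma star_refl l : star l l.
Proof. by rewrite /star /= eqxx. Qed.

Lemma parabolic_star_commute l g : parabolic (star l) g -> commute (gen l) g.
Proof.
move=> [w Sw ->]; elim: w Sw => [_|[z b] w IH /=]; first exact: commute1.
move=> /andP[/= lz /IH lw]; rewrite eval_cons; apply: commuteM => //.
rewrite eval_letter; have lz' : commute (gen l) (gen z).
  by case/orP: lz => [/eqP ->|/gen_commute//].
by case: b; [|exact: commuteV].
Qed.

(** The suffixes of w are the successive vertices of the path from 1 to the
    value of w.  The letters crossed commute, so this is the exponent of l
    counted along the path; it is recorded as an element of A, which makes
    [crossing_parabolic1] an identity in A. *)
Fixpoint crossing_word (l : V) (w : word V) : A :=
  if w is x :: w' then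
    if (x.1 == l) && `[< parabolic (star l) (eval_word w') >]
    then eval_word [:: x] * crossing_word l w' else crossing_word l w'
  else 1.

Lemma crossing_word_cons l x w :
  crossing_word l (x :: w) =
  if (x.1 == l) && `[< parabolic (star l) (eval_word w) >]
  then eval_word [:: x] * crossing_word l w else crossing_word l w.
Proof. by []. Qed.

Lemma asbool_parabolic_cons (S : pred V) x w :
  S x.1 ->
  `[< parabolic S (eval_word (x :: w)) >] = `[< parabolic S (eval_word w) >].
Proof.
move=> Sx; apply: asbool_equiv_eq; rewrite eval_cons.
exact/parabolicMl/parabolic_letter.
Qed.

(** The subgroup generated by the star of l is stable under multiplication by
    l and by its neighbours.  So a cancelling pair of letters l contributes
    inverse letters or nothing, and so do the two letters l of a commutator,
    whose positions differ by a neighbour of l. *)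
Lemma crossing_word_eq l u w :
  word_eq E u w -> crossing_word l u = crossing_word l w.
Proof.
elim=> {u w} [u r w rr|//|u w _ -> //|u t w _ -> _ -> //].
have erw : eval_word (r ++ w) = eval_word w.
  by apply: raag_eq; apply: (word_eq_relator [::]).
suff rw : crossing_word l (r ++ w) = crossing_word l w.
  elim: u => //= x u ->; congr (if _ && `[< parabolic _ _ >] then _ else _).
  by rewrite !(eval_cat u) erw.
case: rr {erw} => [[x b]|a b Eab].
  rewrite !cat_cons cat0s !crossing_word_cons /=; case: eqP => [->|//] /=.
  rewrite asbool_parabolic_cons ?star_refl//.
  by case: asboolP => // _; rewrite !eval_letter; case: b; rewrite /= ?mulVKg ?mulKg.
rewrite !cat_cons cat0s !crossing_word_cons /=.
have [al|al] /= := eqVneq a l.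
  have bl : (b == l) = false by apply: contraTF Eab => /eqP->; rewrite al Eirr.
  have Sa : star l a by rewrite al star_refl.
  have Sb : star l b by rewrite /star /= -al Eab orbT.
  rewrite bl /= !asbool_parabolic_cons //; case: asboolP => // _.
  by rewrite !eval_letter mulKg.
have [bl|//] /= := eqVneq b l.
have Sb : star l b by rewrite bl star_refl.
have Sa : star l a by rewrite /star /= -bl Esym Eab orbT.
rewrite !asbool_parabolic_cons //; case: asboolP => // _.
by rewrite !eval_letter mulKg.
Qed.

Definition crossing l (g : A) := crossing_word l (repr g).

Lemma crossing_eval l w : crossing l (eval_word w) = crossing_word l w.
Proof. exact/crossing_word_eq/word_eq_repr. Qed.

Lemma crossing1 l : crossing l 1 = 1.
Proof. exact: (crossing_eval l [::]). Qed.

Lemma crossing_letter l x g : ~ (x.1 = l /\ parabolic (star l) g) ->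
  crossing l (eval_word [:: x] * g) = crossing l g.
Proof.
move=> xg; rewrite -(eval_repr g) -eval_cons !crossing_eval crossing_word_cons.
by case: ifP => // /andP[/eqP xl /asboolP lg]; case: xg; rewrite -(eval_repr g).
Qed.

Lemma crossing_own_letter l b g : parabolic (star l) g ->
  crossing l (eval_word [:: (l, b)] * g) = eval_word [:: (l, b)] * crossing l g.
Proof.
move=> lg; rewrite -(eval_repr g) -eval_cons !crossing_eval crossing_word_cons.
by rewrite eqxx; case: asboolP => //; rewrite eval_repr.
Qed.

Lemma crossing_gen l g : parabolic (star l) g ->
  crossing l (gen l * g) = gen l * crossing l g.
Proof. exact: (@crossing_own_letter l true). Qed.

(** Translating a path by gen l on the right moves no edge in or out of the
    subgroup generated by the star of l. *)
Lemma crossingMr l g : crossing l (g * gen l) = crossing l g * gen l.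
Proof.
rewrite -(eval_repr g); elim: (repr g) => [|x w IH].
  by rewrite eval_nil crossing1 !mul1g -[X in crossing l X]mulg1 crossing_gen
    ?crossing1 ?mulg1//; exact: parabolic1.
have Sl : parabolic (star l) (gen l) by apply/parabolic_gen/star_refl.
rewrite eval_cons -mulgA.
have [[xl lw]|xw] := pselect (x.1 = l /\ parabolic (star l) (eval_word w)).
  case: x xl => _ b /= ->; rewrite !crossing_own_letter ?IH ?mulgA//.
  exact/parabolicMr.
rewrite !crossing_letter // => -[xl /(parabolicMr _ Sl) lw].
exact: xw.
Qed.

Lemma gen_neq1 l : gen l != 1.
Proof.
apply/eqP => /(congr1 (parity l)); rewrite parity_gen eqxx.
by rewrite (parity_eval l [::]).
Qed.

Lemma crossing_parabolic1 l g : parabolic (pred1 l) g -> crossing l g = g.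
Proof.
move=> [w + ->]; elim: w => [_|[z b] w IH /= /andP[/= /eqP-> lw]].
  exact: crossing1.
rewrite eval_cons crossing_own_letter ?IH//.
by apply: (@sub_parabolic (pred1 l)); [move=> y; rewrite /star /= => -> | exists w].
Qed.

(** Computed on the right, crossing l (g * gen l) has one more factor gen l than
    crossing l g.  Computed on the left, as crossing l (gen l * g), it gains
    this factor only if g lies in the subgroup. *)
Lemma commute_gen_parabolic l g : commute (gen l) g -> parabolic (star l) g.
Proof.
move=> lg; apply: contrapT => nSg.
have := crossingMr l g; rewrite -lg (@crossing_letter l (l, true)); last by case.
move=> /(canLR (mulKg _)); rewrite mulVg => /eqP.
by rewrite eq_sym (negbTE (gen_neq1 l)).
Qed.

(** A discrete intermediate value principle: if the value of [crossing l]
    changes along the path t started at h, the path meets the subgroup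
    generated by the star of l. *)
Lemma crossing_walk l (S : pred V) t h : spelled S t ->
  crossing l (eval_word t * h) <> crossing l h ->
  S l /\ exists2 y, parabolic S y & parabolic (star l) (y * h).
Proof.
elim: t => [_|x t IH /= /andP[Sx St]]; first by rewrite eval_nil mul1g.
rewrite eval_cons -mulgA.
have [[xl lt] _|xt] := pselect (x.1 = l /\ parabolic (star l) (eval_word t * h)).
  by split; [rewrite -xl | exists (eval_word t) => //; exists t].
by rewrite crossing_letter //; exact: IH.
Qed.

Lemma gen_conj_star w s g : parabolic (star w) s -> gen w ^ (s * g) = gen w ^ g.
Proof. by move=> /parabolic_star_commute ws; rewrite conjgM (conjg_commute ws). Qed.

(** The path is a word for w^g in the star of u; it is started at g^-1, and ends
    at g^-1 * gen w, where [crossing w] has a different value.  It must meet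
    the subgroup generated by the star of w. *)
Lemma commute_gen_conj_gen w g u : commute (gen u) (gen w ^ g) ->
  star u w /\ exists2 y, parabolic (star u) y & parabolic (star w) (y * g^-1).
Proof.
move=> /commute_gen_parabolic[t Ut pt].
apply: (crossing_walk Ut); rewrite -pt conjgE mulgA mulgK crossingMr //.
move=> /(canRL (mulKg _)); rewrite mulVg => /eqP.
by rewrite (negbTE (gen_neq1 w)).
Qed.

(** With y as common conjugator, w^g = w^y and z^k = z^y. *)
Lemma commute_gen_conj w g z k : commute (gen w ^ g) (gen z ^ k) ->
  star z w /\
  exists y, parabolic (star w) (y * g^-1) /\ parabolic (star z) (y * k^-1).
Proof.
rewrite -(commuteJ _ _ k^-1) conjgK -conjgM => /commute_sym.
move=> /commute_gen_conj_gen[zw [y zy]]; rewrite invgM invgK mulgA => wy.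
by split=> //; exists (y * k); rewrite mulgK.
Qed.

(** A change of value needs l to be in the star of w, and a y in the subgroup
    generated by this star such that y * g centralizes l.  Conjugating w and l
    by y * g gives w^g and l, which would then commute. *)
Lemma crossing_star_coset l w s g : ~ commute (gen w ^ g) (gen l) ->
  parabolic (star w) s -> crossing l (s * g) = crossing l g.
Proof.
move=> wgl [t wt ->]; apply: contrapT => /(crossing_walk wt)[wl [y wy ly]].
apply: wgl; rewrite -(gen_conj_star g wy).
rewrite -(conjg_commute (parabolic_star_commute ly)); apply/commuteJ.
by case/orP: wl => [/eqP->//|/gen_commute].
Qed.

Lemma crossing_commute l w g z k : commute (gen w ^ g) (gen z ^ k) ->
  ~ commute (gen w ^ g) (gen l) -> ~ commute (gen z ^ k) (gen l) ->
  crossing l g = crossing l k.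
Proof.
move=> /commute_gen_conj[_ [y [wy zy]]] wl zl.
rewrite -(crossing_star_coset wl wy) -(crossing_star_coset zl zy).
by rewrite !mulgVK.
Qed.

(** * Links in the extension graph *)

Lemma ext_adjP x y :
  reflect [/\ ext_vertex x, ext_vertex y, x <> y & commute x y] (@ext_adj V E x y).
Proof. exact: asboolP. Qed.

Lemma ext_adj_sym : symmetric (@ext_adj V E).
Proof.
by move=> x y; apply/ext_adjP/ext_adjP => -[hx hy xy c]; split=> //; exact/nesym.
Qed.

Lemma ext_vertexJ (x h : A) : ext_vertex x -> ext_vertex (x ^ h).
Proof. by move=> [v [g ->]]; exists v, (g * h); rewrite conjgM. Qed.

Lemma ext_adjJ (x y h : A) : ext_adj (x ^ h) (y ^ h) = ext_adj x y.
Proof.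
apply/ext_adjP/ext_adjP => -[hx hy xy c]; split.
- by rewrite -(conjgK h x); exact: ext_vertexJ.
- by rewrite -(conjgK h y); exact: ext_vertexJ.
- by move=> exy; apply: xy; rewrite exy.
- exact/commuteJ/c.
- exact: ext_vertexJ.
- exact: ext_vertexJ.
- by move=> /conjg_inj.
- exact/commuteJ.
Qed.

Lemma gen_vertex v g : ext_vertex (gen v ^ g).
Proof. by exists v, g. Qed.

Lemma gen_vertex1 v : ext_vertex (gen v).
Proof. by exists v, 1; rewrite conjg1. Qed.

Lemma parabolic_link_commute u f : parabolic (E u) f -> commute (gen u) f.
Proof.
move=> uf; apply: parabolic_star_commute; apply: sub_parabolic uf => z.
by rewrite /star /= => ->; rewrite orbT.
Qed.

(** The letter u centralizes everything in sight and can be dropped from y. *)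
Lemma conj_star_link u (a y : A) : commute (gen u) a -> parabolic (star u) y ->
  exists2 f, parabolic (E u) f & a ^ y = a ^ f.
Proof.
move=> + [t + ->]; elim: t a => [|[z b] t IH] a ua /=.
  by exists 1; [exact: parabolic1 | ].
move=> /andP[/= uz ut]; rewrite eval_cons conjgM.
have [zu|zu] := eqVneq z u.
  rewrite (@conjg_commute _ a); first exact: IH.
  by rewrite eval_letter zu; case: b; [|apply: commuteV]; exact: commute_sym.
have Euz : E u z by move: uz; rewrite /star /= (negbTE zu).
have Px : parabolic (E u) (eval_word [:: (z, b)]) by exact: parabolic_letter.
have [|f uf ->] := IH (a ^ eval_word [:: (z, b)]) _ ut.
  by rewrite -(conjg_commute (parabolic_link_commute Px)); exact/commuteJ.
by exists (eval_word [:: (z, b)] * f); [exact: parabolicM | rewrite conjgM].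
Qed.

Lemma Lk_gen u p : Lk (gen u) p ->
  exists w f, [/\ E u w, parabolic (E u) f & p = gen w ^ f].
Proof.
move=> /ext_adjP[_ [w [g ->]] ugp ugc].
have [uw [y uy wy]] := commute_gen_conj_gen ugc.
have pE : gen w ^ g = gen w ^ y by rewrite -(gen_conj_star g wy) mulgVK.
have Euw : E u w.
  case/orP: uw => // /eqP wu; case: ugp.
  by rewrite pE wu conjg_commute //; exact: parabolic_star_commute.
have [f uf ef] := conj_star_link (gen_commute Euw) uy.
by exists w, f; rewrite -ef.
Qed.

Lemma gen_Lk u w f : E u w -> parabolic (E u) f -> Lk (gen u) (gen w ^ f).
Proof.
move=> Euw uf; have uE := conjg_commute (parabolic_link_commute uf).
apply/ext_adjP; split; [exact: gen_vertex1 | exact: gen_vertex | |].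
  rewrite -{1}uE => /conj_gen_inj wu; by rewrite wu Eirr in Euw.
by rewrite -uE; apply/commuteJ/gen_commute.
Qed.

Section TriangleAndSquareFree.
Hypotheses (Etri : triangle_free E) (Esq : square_free E).

Lemma link_independent u a b : E u a -> E u b -> ~~ E a b.
Proof.
move=> ua ub; apply/negP => ab; apply: (Etri (a := u) (b := a) (c := b)).
split=> //; last by rewrite Esym.
rewrite /= !inE !negb_or andbT -andbA; apply/and3P; split.
- by apply: contraTneq ua => ->; rewrite Eirr.
- by apply: contraTneq ub => ->; rewrite Eirr.
- by apply: contraTneq ab => ->; rewrite Eirr.
Qed.

(** Otherwise u, a, z, b would be a square with no diagonal. *)
Lemma common_neighbor u a b z :
  E u a -> E u b -> a != b -> star a z -> star b z -> z = u.
Proof.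
move=> ua ub ab az bz; apply: contrapT => /eqP zu.
have nab := link_independent ua ub.
have Eaz : E a z.
  case/orP: az => // /eqP za; move: bz; rewrite za /star /= (negbTE ab) /=.
  by rewrite Esym (negbTE nab).
have Ebz : E b z.
  case/orP: bz => // /eqP zb; move: az; rewrite zb /star /= eq_sym (negbTE ab) /=.
  by rewrite (negbTE nab).
have Eau : E a u by rewrite Esym.
apply: (Esq (a := u) (b := a) (c := z) (d := b)); split=> //.
- rewrite /= !inE !negb_or andbT (eq_sym u z) zu ab (eq_sym z b).
  have ne x y : E x y -> x != y by apply: contraTneq => ->; rewrite Eirr.
  by rewrite !ne.
- by split=> //; rewrite Esym.
- exact: link_independent Eau Eaz.
Qed.

(** Two commuting vertices of the link would have a common conjugator, and come
    from two vertices of the link of u in the defining graph, necessarily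
    equal; the two conjugates are then equal as well. *)
Lemma Lk_independent_gen u p q : Lk (gen u) p -> Lk (gen u) q -> ~~ ext_adj p q.
Proof.
move=> /Lk_gen[w [f [uw uf ->]]] /Lk_gen[z [g [uz ug ->]]].
apply/negP => /ext_adjP[_ _ ne /commute_gen_conj[wz [y [wy zy]]]].
have [zw|nzw] := eqVneq z w; last first.
  move: wz; rewrite /star /= eq_sym (negbTE nzw) /=.
  by rewrite (negbTE (link_independent uz uw)).
apply: ne; rewrite zw in zy *.
by rewrite -(gen_conj_star f wy) -(gen_conj_star g zy) !mulgVK.
Qed.

(** * Separation by stars *)

Lemma off_star_commute l w g :
  gen w ^ g != gen l -> ~~ ext_adj (gen l) (gen w ^ g) ->
  ~ commute (gen w ^ g) (gen l).
Proof.
move=> ne /ext_adjP nadj c; apply: nadj; split.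
- exact: gen_vertex1.
- exact: gen_vertex.
- by apply/eqP; rewrite eq_sym.
- exact: commute_sym.
Qed.

(** This makes [crossing l] an invariant of the components of the complement of
    the star of l. *)
Lemma crossing_joined l w g z k : joined (gen l) (gen w ^ g) (gen z ^ k) ->
  crossing l g = crossing l k.
Proof.
have step w1 g1 w2 g2 : commute (gen w1 ^ g1) (gen w2 ^ g2) ->
    gen w1 ^ g1 != gen l /\ ~~ ext_adj (gen l) (gen w1 ^ g1) ->
    gen w2 ^ g2 != gen l /\ ~~ ext_adj (gen l) (gen w2 ^ g2) ->
    crossing l g1 = crossing l g2.
  by move=> c [? ?] [? ?]; apply: crossing_commute c _ _ => //;
    exact: off_star_commute.
move=> [p []]; elim: p w g => [|y p IH] w g /=.
  move=> _ wz av; apply: (step w g z k); [by rewrite wz | |].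
    by apply: av; rewrite inE.
  by rewrite -wz; apply: av; rewrite inE.
move=> /andP[/ext_adjP[_ [w' [g' ->]] _ c] yp] lp av.
rewrite -(IH w' g') //; last by move=> a ap; apply: av; rewrite inE ap orbT.
by apply: (step w g w' g') => //; apply: av; rewrite !inE eqxx ?orbT.
Qed.

(** The suffix s2 is where a letter l is crossed for the last time.  There the
    path is in the subgroup generated by the star of l, and also in the one
    generated by the link of u; their intersection is generated by l, so the
    crossings made so far multiply to the current position.  The crossing
    of the last letter of the word, made at 1, ensures that s2 is not empty. *)
Lemma crossing_rcons_suffix u l b t : E u l ->
  spelled (E u) (rcons t (l, b)) ->
  exists s1 s2, [/\ rcons t (l, b) = s1 ++ s2, s2 != [::] &
                    crossing l (eval_word (rcons t (l, b))) = eval_word s2].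
Proof.
move=> ul; elim: t => [_|x t IH /= /andP[ux St]].
  exists [::], [:: (l, b)]; split=> //.
  rewrite /= -[eval_word _]mulg1 crossing_own_letter ?crossing1//.
  exact: parabolic1.
have {IH} [s1 [s2 [ts s2n cs]]] := IH St.
rewrite eval_cons; have [[xl lt]|xt] :=
    pselect (x.1 = l /\ parabolic (star l) (eval_word (rcons t (l, b)))).
  exists [::], (x :: rcons t (l, b)); split=> //.
  case: x xl ux => _ c /= -> ux.
  rewrite crossing_own_letter // [RHS]eval_cons crossing_parabolic1 //.
  have Pt : parabolic (E u) (eval_word (rcons t (l, b))) by exists (rcons t (l, b)).
  apply: sub_parabolic (parabolicI Pt lt) => z /= /andP[uz].
  rewrite /star /= => /orP[//|lz].
  by rewrite (negbTE (link_independent ul uz)) in lz.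
exists (x :: s1), s2; split=> //; first by rewrite ts.
by rewrite crossing_letter.
Qed.

Lemma link_group_parabolic u (g : A) : parabolic (E u) g -> link_group u g.
Proof.
move=> [t + ->] H [[H1 HF] HS].
have HV x : H x -> H x^-1 by move=> Hx; rewrite -div1g; exact: HF.
elim: t => [_|[z b] t IH /= /andP[/= uz /IH Ht]]; first exact: H1.
rewrite eval_cons -(invgK (eval_word t)); apply: HF; last exact: HV.
rewrite eval_letter; case: b; [|apply: HV]; by apply: HS; exists z.
Qed.

Lemma parabolic_link_group u (g : A) : link_group u g -> parabolic (E u) g.
Proof.
apply; split=> [|x [w uw ->]]; last exact: parabolic_gen.
split; first exact: parabolic1.
by move=> x y Hx Hy; apply: parabolicM => //; exact: parabolicV.
Qed.

Lemma joined_offJ (m x y h : A) :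
  joined m x y -> joined (m ^ h) (x ^ h) (y ^ h).
Proof.
move=> [p [xp lp av]]; exists (map (fun z => z ^ h) p); split.
- elim: p x xp {lp av} => //= z p IH x /andP[xz zp].
  by rewrite ext_adjJ xz IH.
- by rewrite (last_map (fun z => z ^ h)) lp.
- move=> z; rewrite -(map_cons (fun z => z ^ h)) => /mapP[a /av[am ma] ->].
  by rewrite ext_adjJ; split=> //; apply: contraNneq am => /conjg_inj ->.
Qed.

Lemma link_adj_conj u w z g : E u w -> E u z -> w != z -> parabolic (E u) g ->
  link_adj u (gen w ^ g) (gen z ^ g).
Proof.
move=> uw uz wz ug; apply/asboolP; split.
  by move=> /conj_gen_inj wz'; rewrite wz' eqxx in wz.
by exists w, z, g; split=> //; exact: link_group_parabolic.
Qed.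

(** Induction on the length of t.  If the last letter of t is w, it can be moved
    to the conjugator g of w.  Otherwise let l be this letter: l^g is adjacent
    to p in the link.  If it is not q, it separates p from q unless
    [crossing l] takes the value 1 at t.  In that case a nonempty suffix of t is trivial in A, and
    can be dropped. *)
Lemma link_separation_word u w z t g :
  E u w -> E u z -> spelled (E u) t -> parabolic (E u) g ->
  let p := gen w ^ g in let q := gen z ^ (eval_word t * g) in
  [\/ p = q, link_adj u p q |
      exists m, [/\ Lk (gen u) m, m <> p, m <> q, link_adj u p m &
                    ~ joined m p q]].
Proof.
move=> uw uz; have [n] := ubnP (size t); elim: n t w g uw => // n IH t w g uw.
case/lastP: t => [_ _ ug p q|t [l b]].
  rewrite {}/p {}/q eval_nil mul1g; have [->|wz] := eqVneq w z; first exact: Or31.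
  exact/Or32/link_adj_conj.
rewrite size_rcons ltnS => tn ut ug p q.
have [ul ut'] : E u l /\ spelled (E u) t.
  by move: ut; rewrite /spelled all_rcons => /andP[].
have ulb : parabolic (E u) (eval_word [:: (l, b)]) by exact: parabolic_letter.
have [lw|lw] := eqVneq l w.
  have pE : p = gen w ^ (eval_word [:: (l, b)] * g).
    rewrite gen_conj_star // lw; apply: parabolic_letter; exact: star_refl.
  rewrite pE /q -cats1 eval_cat -mulgA; apply: IH => //.
  exact: parabolicM.
have pm : link_adj u p (gen l ^ g) by apply: link_adj_conj; rewrite // eq_sym.
have [qm|qm] := eqVneq q (gen l ^ g); first by apply: Or32; rewrite qm.
have [pq|npq] := pselect (joined (gen l ^ g) p q); last first.
  apply: Or33; exists (gen l ^ g); split=> //; first exact: gen_Lk.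
    by move=> /conj_gen_inj lw'; rewrite lw' eqxx in lw.
  by move/esym/eqP; rewrite (negbTE qm).
(* Conjugate by g^-1, so that the star considered is that of gen l. *)
have := joined_offJ g^-1 pq; rewrite !conjgK -conjgM mulgK -[gen w]conjg1.
move=> /crossing_joined; rewrite crossing1 // => cross.
have [s1 [s2 [ts s2n]]] := crossing_rcons_suffix ul ut.
rewrite -cross // => s21.
have qE : q = gen z ^ (eval_word s1 * g) by rewrite /q ts eval_cat -s21 mulg1.
rewrite qE; apply: IH => //.
- apply: leq_ltn_trans tn; rewrite -ltnS -(size_rcons t (l, b)) ts size_cat.
  by rewrite -addn1 leq_add2l lt0n size_eq0.
- by move: ut; rewrite ts /spelled all_cat => /andP[].
Qed.

(** The separating vertex is moreover a neighbour of p in the link; this is what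
    [Lk_common_neighbor_gen] uses to reduce to adjacent vertices. *)
Lemma link_separation u (p q : A) : Lk (gen u) p -> Lk (gen u) q ->
  [\/ p = q, link_adj u p q |
      exists m, [/\ Lk (gen u) m, m <> p, m <> q, link_adj u p m &
                    ~ joined m p q]].
Proof.
move=> /Lk_gen[w [g [uw ug ->]]].
move=> /Lk_gen[z [k [uz uk ->]]].
have [t ut tE] : parabolic (E u) (k * g^-1).
  by apply: parabolicM => //; exact: parabolicV.
by rewrite -(mulgVK g k) tE; exact: link_separation_word.
Qed.

Lemma joined_edges (m x y z : A) : ext_adj x y -> ext_adj y z ->
  (forall a, a \in [:: x; y; z] -> a != m /\ ~~ ext_adj m a) -> joined m x z.
Proof. by move=> xy yz av; exists [:: y; z]; rewrite /= xy yz. Qed.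

(** For p = w^g and q = z^g, the element x^(g^-1) lies in the centralizers of w
    and z, so in the subgroup generated by the intersection of their stars,
    which is u alone.  A conjugate of a generator that is a power of u is u. *)
Lemma link_adj_common_neighbor u (p q x : A) :
  link_adj u p q -> ext_adj p x -> ext_adj x q -> x = gen u.
Proof.
move=> /asboolP[+ [w [z [g [uw uz + pE qE]]]]]; rewrite {}pE {}qE => pq.
move=> /parabolic_link_group ug px xq.
have wz : w != z by apply: contra_notN pq => /eqP ->.
have [v [h xE]] : ext_vertex (x ^ g^-1).
  by apply: ext_vertexJ; case/ext_adjP: px.
have Px : parabolic (star w) (x ^ g^-1).
  apply: commute_gen_parabolic => //.
  by apply/(commuteJ _ _ g); rewrite conjgKV; case/ext_adjP: px.
have Pz : parabolic (star z) (x ^ g^-1).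
  apply: commute_gen_parabolic => //; apply/(commuteJ _ _ g); rewrite conjgKV.
  by apply: commute_sym; case/ext_adjP: xq.
have Pu : parabolic (pred1 u) (x ^ g^-1).
  apply: sub_parabolic (parabolicI Px Pz) => y /andP[wy zy] /=.
  by apply/eqP; apply: common_neighbor uw uz wz wy zy.
have vu : v = u.
  apply/eqP; apply: contrapT => /negP vu.
  have := parity_parabolic (S := pred1 u) vu Pu.
  by rewrite xE parityJ parity_gen eqxx.
have cu : commute (gen u) (gen u ^ h).
  rewrite -vu -xE; apply: parabolic_star_commute; apply: sub_parabolic Pu => y.
  by move=> /eqP ->; rewrite vu star_refl.
rewrite -(conjgKV g x) xE vu.
have [_ [y uy uy']] := commute_gen_conj_gen cu.
have -> : gen u ^ h = gen u.
  by rewrite -(gen_conj_star h uy') mulgVK conjg_commute //;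
    exact: parabolic_star_commute.
by rewrite conjg_commute //; exact: parabolic_link_commute.
Qed.

(** If p and q are not adjacent in the link, let m be adjacent to p and separate
    p from q.  The path p, x, q must meet the star of m, and can do so only
    at x; then x is also a common neighbour of p and m, which are adjacent. *)
Lemma Lk_common_neighbor_gen u (p q x : A) : Lk (gen u) p -> Lk (gen u) q ->
  p <> q -> ext_adj p x -> ext_adj x q -> x = gen u.
Proof.
move=> up uq pq px xq.
have [//|pq'|[m [um mp mq pm nj]]] := link_separation up uq.
  exact: link_adj_common_neighbor pq' px xq.
have indep := Lk_independent_gen.
apply: (link_adj_common_neighbor pm) => //; rewrite ext_adj_sym.
apply: contrapT => /negP mx; apply: nj; apply: (joined_edges px xq) => a.
rewrite !inE => /or3P[] /eqP ->.
- by split; [apply/eqP/nesym | exact: indep um up].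
- split=> //; apply/negP => /eqP xm; case/negP: (indep _ _ _ up um).
  by rewrite -xm.
- by split; [apply/eqP/nesym | exact: indep um uq].
Qed.

End TriangleAndSquareFree.
End ParabolicSubgroups.

(** * Transport to an arbitrary vertex *)

Section BoundedProjections.
Variables (V : finType) (E : rel V).
Hypotheses (Esym : symmetric E) (Eirr : irreflexive E).
Hypotheses (Etri : triangle_free E) (Esq : square_free E).
Variables (u : V) (h : raag E).

Local Notation A := (raag E).
Local Notation v := (raag_gen E u ^ h).
Local Notation joined := (joined_off (@ext_adj V E)).

Lemma LkJ (a x g : A) : Lk (a ^ g) (x ^ g) <-> Lk a x.
Proof. by rewrite /Lk /= ext_adjJ. Qed.

Lemma Lk_conj (x : A) : ext_adj v x -> Lk (raag_gen E u) (x ^ h^-1).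
Proof. by move=> vx; apply/(LkJ _ _ h); rewrite conjgKV. Qed.

Lemma Lk_independent (p q : A) : ext_adj v p -> ext_adj v q -> ~~ ext_adj p q.
Proof.
move=> /Lk_conj up /Lk_conj uq; rewrite -(ext_adjJ _ _ h^-1).
exact: (Lk_independent_gen Esym Eirr Etri up uq).
Qed.

Lemma Lk_common_neighbor (p q x : A) : ext_adj v p -> ext_adj v q ->
  p <> q -> ext_adj p x -> ext_adj x q -> x = v.
Proof.
move=> /Lk_conj up /Lk_conj uq pq px xq; apply: (@conjg_inj _ h^-1).
rewrite conjgK.
apply: (Lk_common_neighbor_gen Esym Eirr Etri Esq up uq); rewrite ?ext_adjJ //.
by move=> /conjg_inj.
Qed.

Definition conj_link_adj : rel A := fun x y => link_adj u (x ^ h^-1) (y ^ h^-1).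

Lemma conj_link_adj_sym : symmetric conj_link_adj.
Proof.
move=> x y; apply/asboolP/asboolP => -[xy [a [b [g [ua ub ug xa yb]]]]];
  by split; [exact/nesym | exists b, a, g].
Qed.

Lemma unseparated_link_adj (p q : A) : ext_adj v p -> ext_adj v q ->
  (forall m, ext_adj v m -> m <> p -> m <> q -> joined m p q) ->
  dist_le conj_link_adj p q 1.
Proof.
move=> /Lk_conj up /Lk_conj uq sep.
have [pq|pq|[m [um mp mq _ nj]]] :=
    link_separation Esym Eirr Etri up uq.
- by move/conjg_inj: pq => ->; exact: dist_le_refl.
- by exists [:: q]; rewrite /= andbT.
case: nj; rewrite -(conjgK h m); apply: joined_offJ; apply: sep.
- by rewrite ext_adjJ.
- by move=> mhp; apply: mp; rewrite -mhp conjgK.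
- by move=> mhq; apply: mq; rewrite -mhq conjgK.
Qed.

Lemma proj_shadow (x p : A) : proj v x p -> shadow (@ext_adj V E) v x p.
Proof.
move=> [s [g ps vp]].
have eirr : irreflexive (@ext_adj V E) by move=> a; apply/ext_adjP => -[].
exact: (geodesic_shadow (@ext_adj_sym V E) eirr Lk_independent
  Lk_common_neighbor g ps vp).
Qed.

End BoundedProjections.

Section Diameter.
Variables (V : finType) (E : rel V).

Lemma link_diam_leP v (S : set (raag E)) n :
  (forall u h, v = raag_gen E u ^ h -> diam_le (conj_link_adj u h) S n) ->
  link_diam_le v S n.
Proof.
move=> Sn u h vE _ _ [x Sx <-] [y Sy <-].
have [p [xp py pn]] := Sn u h vE x y Sx Sy.
exists (map (fun z => z ^ h^-1) p); split; last by rewrite size_map.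
- elim: p x xp {Sx py pn} => //= z p IH x /andP[xz zp].
  by apply/andP; split; [exact: xz | exact: IH].
- by rewrite (last_map (fun z => z ^ h^-1)) py.
Qed.

End Diameter.

Theorem theorem56 (V : finType) (E : rel V)
    (Esym : symmetric E) (Eirr : irreflexive E)
    (Econn : forall x y : V, connect E x y)
    (Etri : triangle_free E) (Esq : square_free E) :
  (exists M : nat,
    (forall v v' : raag E, ext_vertex v -> ext_vertex v' ->
       link_diam_le v (proj v v') M) /\
    (forall (v : raag E) (K : set (raag E)),
       ext_vertex v -> K `<=` @ext_vertex V E ->
       connected_set (@ext_adj V E) K ->
       (forall x, K x -> ~ dist_le (@ext_adj V E) v x 2) ->
       link_diam_le v (proj_set v K) M)) /\
  (exists M' : nat,
    forall (v : raag E) (X : set (raag E)),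
      ext_vertex v ->
      [\/ geodesic_segment (@ext_adj V E) X,
          geodesic_ray (@ext_adj V E) X
        | geodesic_line (@ext_adj V E) X] ->
      X `<=` @ext_vertex V E `\` St v ->
      link_diam_le v (proj_set v X) M').
Proof.
have esym := @ext_adj_sym V E.
have shad := proj_shadow Esym Eirr Etri Esq.
split; [exists 1%N; split | exists 6%N].
- move=> v v' _ _; apply: link_diam_leP => u h -> p q vp vq.
  have unseparated := @unseparated_link_adj V E Esym Eirr Etri u h.
  exact: (shadows_close_same esym unseparated (shad _ _ _ _ vp) (shad _ _ _ _ vq)).
- move=> v K _ _ Kc Kv; apply: link_diam_leP => u h vE p q [x Kx xp] [y Ky yq].
  subst v; have unseparated := @unseparated_link_adj V E Esym Eirr Etri u h.
  exact: (shadows_close_connected esym unseparated Kc Kv Kx Ky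
    (shad _ _ _ _ xp) (shad _ _ _ _ yq)).
move=> v X _ gX Xv; apply: link_diam_leP => u h vE p q [x Xx xp] [y Xy yq].
have off z : X z -> z <> v /\ ~~ ext_adj v z.
  move=> /Xv[_ nSt]; split=> [zv|]; first by apply: nSt; left.
  by apply/negP => vz; apply: nSt; right.
have [s [gs Xs]] : exists s,
    (geodesic (@ext_adj V E) x y s \/ geodesic (@ext_adj V E) y x s) /\
    {in s, forall z, X z}.
  by case: gX => gX; [exact: geodesic_segmentP gX Xx Xy
    | exact: geodesic_rayP gX Xx Xy | exact: geodesic_lineP gX Xx Xy].
subst v.
have indep := @Lk_independent V E Esym Eirr Etri u h.
have common := @Lk_common_neighbor V E Esym Eirr Etri Esq u h.
have unseparated := @unseparated_link_adj V E Esym Eirr Etri u h.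
have close := geodesic_shadows_close esym indep common unseparated.
have offs : {in s, forall z, z <> raag_gen E u ^ h /\ ~~ ext_adj (raag_gen E u ^ h) z}.
  by move=> z /Xs /off.
case: gs => gs.
  by apply: (close _ _ _ _ _ gs offs); exact: shad.
apply: dist_le_sym; first exact: conj_link_adj_sym.
by apply: (close _ _ _ _ _ gs offs); exact: shad.
Qed.
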